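(* Let $\varphi(\mathbf{x})$ be a q-Horn formula with valuation $\gamma$, representing a Boolean function $f(\mathbf{x})$, and let $\mathbf{x}=\mathbf{x}_1\cup\mathbf{x}_2$ be a partition of the variables such that $\gamma(x)\in\{0,1\}$ for every $x\in\mathbf{x}_1$ and $\gamma(x)=\tfrac12$ for every $x\in\mathbf{x}_2$. Then there is a URC encoding $\psi(\mathbf{x},\mathbf{y})$ of $f(\mathbf{x})$ with $|\mathbf{y}|=O(|\mathbf{x}_2|^2)$, $|\psi|=O(|\varphi|+|\mathbf{x}_2|^3)$, and $\|\psi\|=O(\|\varphi\|+|\mathbf{x}_2|^3)$.
   Context: A CNF is a set of clauses; $|\varphi|$ is the number of clauses and $\|\varphi\|=\sum_{C\in\varphi}|C|$ is its length (total number of literal occurrences). A CNF $\varphi$ is q-Horn with valuation $\gamma$ if $\gamma$ assigns to each literal $u$ on the variables of $\varphi$ a value $\gamma(u)\in\{0,\tfrac12,1\}$ with $\gamma(u)+\gamma(\neg u)=1$, and $\sum_{u\in C}\gamma(u)\le 1$ for every clause $C\in\varphi$; $\gamma(x)$ for a variable $x$ means the value on the positive literal $x$. A partial assignment is a set of literals with no complementary pair, identified with their conjunction. Unit resolution derives $C\setminus\{l\}$ from a clause $C\ni l$ and the unit clause $\neg l$; $\varphi\vdash_1\bot$ means the empty clause is derivable by repeated unit resolution. A CNF $\psi(\mathbf{z})$ is URC if for every partial assignment $\alpha$ of $\mathbf{z}$, $\psi\wedge\alpha\models\bot$ implies $\psi\wedge\alpha\vdash_1\bot$. A CNF $\psi(\mathbf{x},\mathbf{y})$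 is an encoding of $f(\mathbf{x})$ if $f(\mathbf{a})=\exists\mathbf{b}\in\{0,1\}^{\mathbf{y}}\,\psi(\mathbf{a},\mathbf{b})$ for all $\mathbf{a}\in\{0,1\}^{\mathbf{x}}$; a URC encoding is an encoding which is URC as a formula on $\mathbf{x}\cup\mathbf{y}$. *)

(* Defs.v *)
From HB Require Import structures.
From mathcomp Require Import all_boot all_order all_algebra.
Set Implicit Arguments.
Unset Strict Implicit.
Unset Printing Implicit Defensive.
Import Order.TTheory GRing.Theory Num.Theory.

(* [(x, true)] is the positive literal x and [(x, false)] its negation. *)
Notation lit V := (V * bool)%type.

Definition neg_lit (V : finType) (l : lit V) : lit V := (l.1, ~~ l.2).

Notation clause V := {set lit V}.

Notation cnf V := {set clause V}.

Definition cnf_length (V : finType) (phi : cnf V) : nat :=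
  \sum_(C in phi) #|C|.

Notation assignment V := {ffun V -> bool}.

Definition lit_eval (V : finType) (a : assignment V) (l : lit V) : bool :=
  a l.1 == l.2.

Definition clause_eval (V : finType) (a : assignment V) (C : clause V) : bool :=
  [exists l in C, lit_eval a l].

Definition cnf_eval (V : finType) (a : assignment V) (phi : cnf V) : bool :=
  [forall C in phi, clause_eval a C].

Definition represents (V : finType) (phi : cnf V) (f : assignment V -> bool) :=
  forall a : assignment V, f a = cnf_eval a phi.

Definition qhorn_valuation (V : finType) (phi : cnf V) (gamma : lit V -> rat) :=
  [/\ forall l : lit V,
        [\/ gamma l = 0%R, gamma l = (1 / 2%:R)%R | gamma l = 1%R],
      forall l : lit V, (gamma l + gamma (neg_lit l) = 1)%R
    & forall C : clause V, C \in phi -> (\sum_(l in C) gamma l <= 1)%R].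

Definition partial_assignment (V : finType) (alpha : {set lit V}) : Prop :=
  forall l : lit V, l \in alpha -> neg_lit l \notin alpha.

(* The conjunction of a CNF with the literals in alpha, as unit clauses. *)
Definition cnf_and (V : finType) (psi : cnf V) (alpha : {set lit V}) : cnf V :=
  psi :|: [set [set l] | l in alpha].

Definition unsat (V : finType) (phi : cnf V) : Prop :=
  forall a : assignment V, ~~ cnf_eval a phi.

Inductive unit_derives (V : finType) (phi : cnf V) : clause V -> Prop :=
| UnitAxiom (C : clause V) : C \in phi -> unit_derives phi C
| UnitResolve (C : clause V) (l : lit V) :
    l \in C -> unit_derives phi C -> unit_derives phi [set neg_lit l] ->
    unit_derives phi (C :\ l).

Definition urc (V : finType) (psi : cnf V) : Prop :=
  forall alpha : {set lit V}, partial_assignment alpha ->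
    unsat (cnf_and psi alpha) -> unit_derives (cnf_and psi alpha) set0.

Definition join_assignment (X Y : finType)
    (a : assignment X) (b : assignment Y) : assignment (X + Y)%type :=
  [ffun z => match z with inl x => a x | inr y => b y end].

Definition encoding (X Y : finType) (psi : cnf (X + Y)%type)
    (f : assignment X -> bool) : Prop :=
  forall a : assignment X,
    f a = [exists b : assignment Y, cnf_eval (join_assignment a b) psi].

Definition urc_encoding (X Y : finType) (psi : cnf (X + Y)%type)
    (f : assignment X -> bool) : Prop :=
  encoding psi f /\ urc psi.

(* Main.v *)
Require Import Defs.
From HB Require Import structures.
From mathcomp Require Import all_boot all_order all_algebra.
From mathcomp Require Import zify lra.
Set Implicit Arguments.
Unset Strict Implicit.
Unset Printing Implicit Defensive.
Import Order.TTheory GRing.Theory Num.Theory.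

(** For every pair of literals [l1], [l2] on the variables of [x2] there is an
    auxiliary variable standing for the clause [l1 \/ l2].  In each clause of
    [phi] the at most two literals of value 1/2 are replaced by the
    corresponding auxiliary variable; this makes the formula Horn up to
    renaming, and we add clauses which force the auxiliary variables to be
    sound and closed under symmetry and under resolution.  If unit propagation
    ends without conflict in a set of literals [U], the Horn part is satisfied by
    giving every undecided variable its default value, and the 2-CNF made of the
    true auxiliary variables is closed under resolution, hence [U] extends
    greedily to one of its models. *)

(** * Unit propagation and literal sets closed under it *)

Section UnitPropagation.
Variable V : finType.
Implicit Types (psi : cnf V) (U D : {set lit V}) (C : clause V) (l : lit V)
  (a : assignment V).

Lemma neg_litK : involutive (@neg_lit V).
Proof. by case=> x b; rewrite /neg_lit /= negbK. Qed.

Lemma lit_eval_neg a l : lit_eval a (neg_lit l) = ~~ lit_eval a l.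
Proof. by rewrite /lit_eval /=; case: (a l.1); case: l.2. Qed.

(** For a unit clause the inner condition is vacuous, so its literal must lie in [U]. Conflicts are
    not excluded here: consistency of [U] is a separate condition. *)
Definition unit_closed psi U :=
  forall C l, C \in psi -> l \in C ->
    (forall l', l' \in C -> l' != l -> neg_lit l' \in U) -> l \in U.

Lemma unit_derivesD psi C D :
  D \subset C -> unit_derives psi C ->
  (forall l, l \in D -> unit_derives psi [set neg_lit l]) ->
  unit_derives psi (C :\: D).
Proof.
move: {2}#|D| (erefl #|D|) => n; elim: n D => [|n IHn] D.
  by move/eqP; rewrite cards_eq0 => /eqP-> _ dC _; rewrite setD0.
move=> cD sDC dC dD.
have /card_gt0P[l lD] : 0 < #|D| by rewrite cD.
have -> : C :\: D = (C :\: (D :\ l)) :\ l.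
  by rewrite setDDl setUC setD1K.
apply: UnitResolve; last exact: dD.
  by rewrite !inE eqxx /= (subsetP sDC).
apply: IHn => //.
- by move: cD; rewrite (cardsD1 l) lD => -[].
- exact: subset_trans (subsetDl _ _) sDC.
- by move=> l'; rewrite inE => /andP[_ /dD].
Qed.

(** Propagated literals are added to the empty set one at a time; the complement of [U] shrinks at
    each step, so the process stops. *)
Lemma unit_closure psi :
  exists2 U, unit_closed psi U & forall l, l \in U -> unit_derives psi [set l].
Proof.
suff grow n : forall U, #|~: U| <= n ->
    (forall l, l \in U -> unit_derives psi [set l]) ->
    exists2 U', unit_closed psi U' &
      forall l, l \in U' -> unit_derives psi [set l].
  by apply: (grow _ set0 (leqnn _)) => l; rewrite inE.
elim: n => [|n IHn] U.
  rewrite leqn0 cards_eq0 => /eqP UT dU; exists U => // C l _ _ _.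
  by apply/negPn; rewrite -in_setC UT inE.
move=> cU dU.
case: (boolP [exists C in psi, exists l in C, (l \notin U) &&
    [forall l' in C, (l' != l) ==> (neg_lit l' \in U)]]); last first.
  move=> nex; exists U => // C l Cpsi lC nU; apply/negPn/negP => lU.
  case/negP: nex; apply/exists_inP; exists C => //; apply/exists_inP.
  exists l => //; rewrite lU; apply/forall_inP => l' l'C; apply/implyP.
  exact: nU.
case/exists_inP=> C Cpsi /exists_inP[l lC /andP[lU /forall_inP nU]].
have dl : unit_derives psi [set l].
  have -> : [set l] = C :\: (C :\ l).
    by rewrite setDDr setDv set0U; apply/esym/setIidPr; rewrite sub1set.
  apply: unit_derivesD (subsetDl _ _) (UnitAxiom Cpsi) _ => l'.
  by rewrite !inE => /andP[l'l l'C]; apply/dU/(implyP (nU _ l'C)).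
apply: (IHn (l |: U)); last by move=> l'; rewrite !inE => /orP[/eqP->|/dU].
have -> : ~: (l |: U) = (~: U) :\ l by rewrite setDE setIC -setCU.
by move: cU; rewrite (cardsD1 l (~: U)) inE lU.
Qed.

(** Reduces URC to extending closed sets to models. If propagation from [psi] and [alpha] ends in
    [U] without a complementary pair and [psi] has no empty clause, a model of [psi] extending [U]
    also satisfies [alpha], against unsatisfiability. *)
Lemma urc_unit_closed psi :
  (forall U, partial_assignment U -> unit_closed psi U -> set0 \notin psi ->
     exists2 a, forall l, l \in U -> lit_eval a l & cnf_eval a psi) ->
  urc psi.
Proof.
move=> ext alpha _ unsat_psi.
have [U closedU dU] := unit_closure (cnf_and psi alpha).
have sub_and C : C \in psi -> C \in cnf_and psi alpha by rewrite inE => ->.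
case: (boolP [exists l in U, neg_lit l \in U]) => [|consU].
  case/exists_inP=> l lU nlU; have -> : set0 = [set l] :\ l by rewrite setDv.
  by apply: UnitResolve (dU _ lU) (dU _ nlU); rewrite inE.
case: (boolP (set0 \in psi)) => [e_psi|ne_psi].
  exact/UnitAxiom/sub_and.
have [|||a aU a_psi] := ext U; [| |exact: ne_psi|].
- by move=> l lU; apply: contra consU => nlU; apply/exists_inP; exists l.
- by move=> C l /sub_and; apply: closedU.
case/negP: (unsat_psi a); apply/forall_inP => C; rewrite inE => /orP[].
  exact: (forall_inP a_psi).
case/imsetP=> l l_alpha ->; apply/exists_inP; exists l; first by rewrite inE.
apply/aU/(closedU [set l]); rewrite ?inE //.
  by rewrite orbC imset_f.
by move=> l'; rewrite inE => /eqP->; rewrite eqxx.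
Qed.

(** If [a] falsified the whole clause, [U] would refute every literal but [p], so propagation would
    put [p] in [U] and [a] would make it true. *)
Lemma clause_eval_unit_closed psi U a C p :
  unit_closed psi U -> (forall l, l \in U -> lit_eval a l) ->
  C \in psi -> p \in C ->
  (forall l, l \in C -> l != p -> ~~ lit_eval a l -> neg_lit l \in U) ->
  clause_eval a C.
Proof.
move=> closedU aU Cpsi pC nU; apply: contraT => /exists_inPn aC.
have /aU : p \in U by apply: (closedU C) => // l lC lp; apply: nU => //; apply: aC.
by rewrite (negbTE (aC _ pC)).
Qed.

End UnitPropagation.

(** * Models of 2-CNFs closed under resolution *)

(* Deciding a literal and everything it forces through [T] keeps [W] closed and
   consistent, because the 2-CNF [T] is already closed under resolution. *)
Lemma resolution_closed_2cnf_sat (Z : finType) (T : rel (lit Z))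
    (W : {set lit Z}) :
  symmetric T ->
  (forall l1 l2 l3, T l1 l2 -> T (neg_lit l2) l3 -> T l1 l3) ->
  partial_assignment W ->
  (forall l1 l2, T l1 l2 -> neg_lit l1 \in W -> l2 \in W) ->
  (forall l, T l l -> l \in W) ->
  exists2 m : assignment Z, forall l, l \in W -> lit_eval m l &
    forall l1 l2, T l1 l2 -> lit_eval m l1 || lit_eval m l2.
Proof.
move=> symT resT.
have [n] := ubnP #|~: W|; elim: n W => // n IHn W cW consW closedW unitW.
case: (pickP [pred z | ((z, true) \notin W) && ((z, false) \notin W)]); last first.
  (* Once every variable is decided, the consistent set [W] is itself an assignment. *)
  move=> total; exists [ffun z => (z, true) \in W].
    move=> [z []] lW; rewrite /lit_eval ffunE /= ?lW //.
    by move: (consW _ lW); rewrite /neg_lit /= => /negbTE->.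
  have evalW l : lit_eval [ffun z => (z, true) \in W] l = (l \in W).
    case: l => z b; rewrite /lit_eval ffunE /=; case: b.
      by rewrite eqb_id.
    have := total z; rewrite /=; have := consW (z, true); rewrite /neg_lit /=.
    by case: ((z, true) \in W) => [/(_ isT)/negbTE->|_ /negbFE->].
  move=> l1 l2 T12; rewrite !evalW orbC -implyNb; apply/implyP => nl2.
  apply: (closedW l2); first by rewrite symT.
  rewrite -evalW lit_eval_neg evalW //.
move=> z /andP[zt zf]; set l := (z, true).
have nlW : neg_lit l \notin W by [].
pose W' := W :|: (l |: [set l' | T (neg_lit l) l']).
have sWW' l' : l' \in W -> l' \in W' by rewrite inE => ->.
have noT l' : T (neg_lit l) l' -> neg_lit l' \notin W.
  by move=> Tl; apply: contra nlW; apply: closedW; rewrite symT.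
have T0 : ~~ T (neg_lit l) (neg_lit l) by apply: contra nlW; apply: unitW.
(* If [l] forced both [l'] and its negation, resolving on [l'] would put the unit clause of
   [neg_lit l] in [T]. *)
have noTT l' : T (neg_lit l) l' -> ~~ T (neg_lit l) (neg_lit l').
  move=> Tl; apply: contra T0 => Tn; apply: resT Tl _.
  by rewrite symT.
have [||||m mW' mT] := IHn W'; last by exists m => // l' /sWW'/mW'.
- move: cW; rewrite ltnS; apply: leq_trans; apply: proper_card; apply/properP; split.
    by rewrite setCS; apply/subsetP.
  by exists l; [rewrite inE | rewrite inE negbK !inE eqxx orbT].
- move=> l'; rewrite !inE => /or3P[l'W|/eqP->|Tl'].
  + rewrite negb_or (consW _ l'W) negb_or /=; apply/andP; split.
      by apply: contraNneq nlW => <-; rewrite neg_litK.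
    by apply/negP => /noT; rewrite neg_litK l'W.
  + by rewrite negb_or nlW negb_or T0 xpair_eqE andbF.
  + rewrite negb_or noT //= negb_or noTT // andbT.
    apply: contraNneq T0 => /(congr1 (@neg_lit Z)); rewrite neg_litK => e.
    by move: Tl'; rewrite e.
- move=> l1 l2 T12; rewrite !inE => /or3P[nW|/eqP e|Tl'].
  + by rewrite (closedW _ _ T12).
  + by rewrite -e neg_litK T12 !orbT.
  + by rewrite (resT _ _ _ Tl') ?orbT ?neg_litK.
- by move=> l' /unitW; apply: sWW'.
Qed.

(** * Length of unions and images of clause sets *)

Section CnfSize.
Variable V : finType.

Lemma cnf_lengthU (phi psi : cnf V) :
  cnf_length (phi :|: psi) <= cnf_length phi + cnf_length psi.
Proof.
rewrite /cnf_length !(big_mkcond (fun C => C \in _)) -big_split /=.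
by apply: leq_sum => C _; rewrite inE; case: (C \in phi); rewrite ?leq_addr.
Qed.

Lemma cnf_length_imset (T : finType) (A : {set T}) (g : T -> clause V) :
  cnf_length (g @: A) <= \sum_(t in A) #|g t|.
Proof.
rewrite (partition_big_imset g) /=; apply: leq_sum => _ /imsetP[t tA ->].
by rewrite (bigD1 t) /= ?tA ?eqxx // leq_addr.
Qed.

Lemma cnf_length_imset_le (T : finType) (A : {set T}) (g : T -> clause V) k :
  (forall t, #|g t| <= k) -> cnf_length (g @: A) <= k * #|A|.
Proof.
move=> gk; apply: leq_trans (cnf_length_imset _ _) _.
by rewrite mulnC -sum_nat_const; apply: leq_sum.
Qed.

End CnfSize.

(** * Construction of the encoding *)

Section Encoding.
Variables (X : finType) (x2 : {set X}).
Implicit Types (phi : cnf X) (C : clause X).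

Local Notation Z := {x : X | x \in x2}.
(* The variable [inr (l1, l2)] stands for the clause [l1 \/ l2]. *)
Local Notation Y := (lit Z * lit Z)%type.

Definition lit_sub (l : lit Z) : lit X := (val l.1, l.2).

Definition lit_inl (l : lit X) : lit (X + Y) := (inl l.1, l.2).

(** For a q-Horn formula these are the literals of value 1/2; selecting them by variable keeps the
    encoding independent of [gamma]. *)
Definition half_part (C : clause X) : clause X := [set l in C | l.1 \in x2].

(** A single half literal [l] is matched by the pair [(l, l)]. Either order of two distinct half
    literals may be picked. *)
Definition translate (C : clause X) : clause (X + Y) :=
  if [pick p : Y | half_part C == [set lit_sub p.1; lit_sub p.2]] is Some p
  then (inr p, true) |: lit_inl @: (C :\: half_part C)
  else lit_inl @: C.

(** For [p = (l, l)] the last two literals coincide, so a true auxiliary variable propagates [l]. *)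
Definition sound_clause (p : Y) : clause (X + Y) :=
  [set (inr p, false); lit_inl (lit_sub p.1); lit_inl (lit_sub p.2)].

Definition swap_clause (p : Y) : clause (X + Y) :=
  [set (inr p, false); (inr (p.2, p.1), true)].

Definition resolution_clause (t : Y * lit Z) : clause (X + Y) :=
  [set (inr t.1, false); (inr (neg_lit t.1.2, t.2), false);
       (inr (t.1.1, t.2), true)].

Definition encode (phi : cnf X) : cnf (X + Y) :=
  (translate @: phi :|: sound_clause @: setT) :|:
  (swap_clause @: setT :|: resolution_clause @: setT).

Lemma translate_in_encode phi C : C \in phi -> translate C \in encode phi.
Proof. by move=> Cphi; rewrite !inE imset_f. Qed.

Lemma sound_in_encode phi p : sound_clause p \in encode phi.
Proof. by rewrite !inE (imset_f sound_clause) ?inE // ?orbT. Qed.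

Lemma swap_in_encode phi p : swap_clause p \in encode phi.
Proof. by rewrite !inE (imset_f swap_clause) ?inE // ?orbT. Qed.

Lemma resolution_in_encode phi t : resolution_clause t \in encode phi.
Proof. by rewrite !inE (imset_f resolution_clause) ?inE // ?orbT. Qed.

Lemma cnf_eval_encode a phi :
  (forall C, C \in phi -> clause_eval a (translate C)) ->
  (forall p, clause_eval a (sound_clause p)) ->
  (forall p, clause_eval a (swap_clause p)) ->
  (forall t, clause_eval a (resolution_clause t)) ->
  cnf_eval a (encode phi).
Proof.
move=> tr so sw re; apply/forall_inP => D.
rewrite !inE => /orP[/orP[] | /orP[]] /imsetP[t t_in ->];
  by [apply: tr | apply: so | apply: sw | apply: re].
Qed.

(** * Size of the encoding *)

Lemma lit_inl_inj : injective lit_inl.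
Proof. by move=> [x b] [x' b'] [-> ->]. Qed.

(** The one added auxiliary literal is paid for by the removed half part, which is nonempty. *)
Lemma card_translate C : #|translate C| <= #|C|.
Proof.
rewrite /translate; case: pickP => [p /eqP halfC | _].
  rewrite cardsU1 card_imset; last exact: lit_inl_inj.
  rewrite -[X in _ <= X](cardsID (half_part C)) leq_add //.
  apply: leq_trans (leq_b1 _) _; rewrite card_gt0; apply/set0Pn.
  exists (lit_sub p.1); rewrite inE.
  have : lit_sub p.1 \in half_part C by rewrite halfC !inE eqxx.
  by move=> h; rewrite h andbT; move: h; rewrite inE => /andP[].
by rewrite card_imset //; apply: lit_inl_inj.
Qed.

Lemma card_lit_sub : #|{: lit Z}| = 2 * #|x2|.
Proof. by rewrite card_prod card_bool card_sig mulnC. Qed.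

Lemma card_pair : #|{: Y}| = 4 * #|x2| ^ 2.
Proof. by rewrite card_prod card_lit_sub; lia. Qed.

Lemma card_triple : #|{: Y * lit Z}| = 8 * #|x2| ^ 3.
Proof. by rewrite card_prod card_pair card_lit_sub; lia. Qed.

Lemma card_set2_le (T : finType) (u v : T) : #|[set u; v]| <= 2.
Proof. by rewrite cards2; case: (_ != _). Qed.

Lemma card_set3_le (T : finType) (u v w : T) : #|[set u; v; w]| <= 3.
Proof.
rewrite setUC cardsU1 (leq_add (leq_b1 _) (card_set2_le _ _)) //.
Qed.

Lemma leq_sqr_cube n : n ^ 2 <= n ^ 3.
Proof. by case: n => // n; rewrite leq_pexp2l. Qed.

Lemma card_encode phi : #|encode phi| <= 44 * (#|phi| + #|x2| ^ 3).
Proof.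
apply: (@leq_trans ((#|phi| + 4 * #|x2| ^ 2) +
                    (4 * #|x2| ^ 2 + 8 * #|x2| ^ 3))); last first.
  by have := leq_sqr_cube #|x2|; lia.
apply: leq_trans (leq_card_setU _ _) _.
apply: leq_add; apply: leq_trans (leq_card_setU _ _) _;
  apply: leq_add; apply: leq_trans (leq_imset_card _ _) _;
  by rewrite ?cardsT ?card_pair ?card_triple.
Qed.

Lemma cnf_length_encode phi :
  cnf_length (encode phi) <= 44 * (cnf_length phi + #|x2| ^ 3).
Proof.
(* The constant is 12 + 8 + 24 = 44: the sound, swap and resolution clauses have at most 3, 2 and 3
   literals, and squares are bounded by cubes. *)
apply: (@leq_trans ((cnf_length phi + 3 * (4 * #|x2| ^ 2)) +
                    (2 * (4 * #|x2| ^ 2) + 3 * (8 * #|x2| ^ 3)))); last first.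
  by have := leq_sqr_cube #|x2|; lia.
apply: leq_trans (cnf_lengthU _ _) _.
rewrite -card_pair -card_triple -!cardsT.
apply: leq_add; apply: leq_trans (cnf_lengthU _ _) _; apply: leq_add.
- apply: leq_trans (cnf_length_imset _ _) _.
  by apply: leq_sum => C _; apply: card_translate.
- by apply: cnf_length_imset_le => p; apply: card_set3_le.
- by apply: cnf_length_imset_le => p; apply: card_set2_le.
- by apply: cnf_length_imset_le => t; apply: card_set3_le.
Qed.

(** * Equivalence of the encoding with the original formula *)

Lemma lit_eval_inl (a : assignment X) (b : assignment Y) l :
  lit_eval (join_assignment a b) (lit_inl l) = lit_eval a l.
Proof. by rewrite /lit_eval ffunE. Qed.

Lemma lit_eval_inr (a : assignment X) (b : assignment Y) p c :
  lit_eval (join_assignment a b) (inr p, c) = (b p == c).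
Proof. by rewrite /lit_eval ffunE. Qed.

Lemma encode_sound (a : assignment X) (b : assignment Y) phi :
  cnf_eval (join_assignment a b) (encode phi) -> cnf_eval a phi.
Proof.
move=> /forall_inP ab; apply/forall_inP => C Cphi.
have /exists_inP[l] := ab _ (translate_in_encode Cphi).
rewrite /translate; case: pickP => [p /eqP halfC | _]; last first.
  by case/imsetP=> l' l'C ->; rewrite lit_eval_inl => al'; apply/exists_inP; exists l'.
rewrite !inE => /orP[/eqP-> | /imsetP[l' + ->]]; last first.
  by rewrite inE lit_eval_inl => /andP[_ l'C] al'; apply/exists_inP; exists l'.
rewrite lit_eval_inr => /eqP bp.
have sub l' : l' \in half_part C -> l' \in C by rewrite inE => /andP[].
have /exists_inP[l'] := ab _ (sound_in_encode phi p).
rewrite !inE -orbA => /or3P[] /eqP->.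
- by rewrite lit_eval_inr bp.
- rewrite lit_eval_inl => al'; apply/exists_inP; exists (lit_sub p.1) => //.
  by apply: sub; rewrite halfC !inE eqxx.
- rewrite lit_eval_inl => al'; apply/exists_inP; exists (lit_sub p.2) => //.
  by apply: sub; rewrite halfC !inE eqxx orbT.
Qed.

Lemma encode_complete (a : assignment X) phi :
  cnf_eval a phi -> exists b, cnf_eval (join_assignment a b) (encode phi).
Proof.
move=> /forall_inP a_phi.
(* Each auxiliary variable takes the truth value of the clause it stands for. *)
exists [ffun p : Y => lit_eval a (lit_sub p.1) || lit_eval a (lit_sub p.2)].
apply: cnf_eval_encode => [C Cphi|p|p|[[l1 l2] l3]].
- have /exists_inP[l lC al] := a_phi _ Cphi.
  rewrite /translate; case: pickP => [p /eqP halfC | _]; last first.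
    by apply/exists_inP; exists (lit_inl l); rewrite ?imset_f ?lit_eval_inl.
  case: (boolP (l \in half_part C)) => lh.
    apply/exists_inP; exists (inr p, true); first by rewrite !inE eqxx.
    rewrite lit_eval_inr ffunE.
    by move: lh; rewrite halfC !inE => /orP[] /eqP<-; rewrite al ?orbT.
  apply/exists_inP; exists (lit_inl l); last by rewrite lit_eval_inl.
  by rewrite inE imset_f ?orbT // inE lh.
- case a1: (lit_eval a (lit_sub p.1)).
    by apply/exists_inP; exists (lit_inl (lit_sub p.1));
      rewrite ?lit_eval_inl // !inE eqxx ?orbT.
  case a2: (lit_eval a (lit_sub p.2)).
    by apply/exists_inP; exists (lit_inl (lit_sub p.2));
      rewrite ?lit_eval_inl // !inE eqxx ?orbT.
  apply/exists_inP; exists (inr p, false); first by rewrite !inE eqxx.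
  by rewrite lit_eval_inr ffunE a1 a2.
- case a12: (lit_eval a (lit_sub p.1) || lit_eval a (lit_sub p.2)).
    apply/exists_inP; exists (inr (p.2, p.1), true); first by rewrite !inE eqxx ?orbT.
    by rewrite lit_eval_inr ffunE orbC a12.
  apply/exists_inP; exists (inr p, false); first by rewrite !inE eqxx.
  by rewrite lit_eval_inr ffunE a12.
- have neg2 : lit_eval a (lit_sub (neg_lit l2)) = ~~ lit_eval a (lit_sub l2).
    by rewrite -lit_eval_neg.
  case a13: (lit_eval a (lit_sub l1) || lit_eval a (lit_sub l3)).
    apply/exists_inP; exists (inr (l1, l3), true); first by rewrite !inE eqxx ?orbT.
    by rewrite lit_eval_inr ffunE a13.
  move/norP: a13 => [/negbTE a1 /negbTE a3].
  case a2: (lit_eval a (lit_sub l2)).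
    apply/exists_inP; exists (inr (neg_lit l2, l3), false).
      by rewrite !inE eqxx ?orbT.
    by rewrite lit_eval_inr ffunE /= neg2 a2 a3.
  apply/exists_inP; exists (inr (l1, l2), false); first by rewrite !inE eqxx.
  by rewrite lit_eval_inr ffunE /= a1 a2.
Qed.

Lemma encoding_encode phi f : represents phi f -> encoding (encode phi) f.
Proof.
move=> rep a; rewrite rep; apply/idP/existsP => [|[b]].
  exact: encode_complete.
exact: encode_sound.
Qed.

(** * Unit refutation completeness *)

Section Urc.
Variables (phi : cnf X) (gamma : lit X -> rat).
Hypothesis qhorn : qhorn_valuation phi gamma.
Hypothesis gamma_half : forall l, l.1 \in x2 -> gamma l = (1 / 2%:R)%R.
Hypothesis gamma_int :
  forall l, l.1 \notin x2 -> gamma l = 0%R \/ gamma l = 1%R.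

Lemma gamma_ge0 l : (0 <= gamma l)%R.
Proof. by case: qhorn => /(_ l) + _ _ => -[] ->. Qed.

Lemma sum_gamma_sub C (S : {set lit X}) :
  C \in phi -> S \subset C -> (\sum_(l in S) gamma l <= 1)%R.
Proof.
case: qhorn => _ _ sumC Cphi SC; apply: le_trans (sumC _ Cphi).
rewrite [leRHS](big_setID S) /= (setIidPr SC) lerDl.
by apply: sumr_ge0 => l _; apply: gamma_ge0.
Qed.

Lemma gamma_pair C l h :
  C \in phi -> l \in C -> h \in C -> l != h -> (gamma l + gamma h <= 1)%R.
Proof.
move=> Cphi lC hC lh; have := @sum_gamma_sub C [set l; h] Cphi.
by rewrite big_setU1 ?inE //= big_set1; apply; rewrite subUset !sub1set lC hC.
Qed.

(** Three literals of value 1/2 would already exceed the bound 1. *)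
Lemma card_half_part C : C \in phi -> #|half_part C| <= 2.
Proof.
move=> Cphi.
have sub : half_part C \subset C by apply/subsetP => l; rewrite inE => /andP[].
have := sum_gamma_sub Cphi sub.
rewrite (eq_bigr (fun=> (1 / 2%:R)%R)); last first.
  by move=> l; rewrite inE => /andP[_ /gamma_half].
by rewrite sumr_const -mulr_natr -(ler_nat rat); lra.
Qed.

(** Ensures that [translate] leaves a clause of [phi] unchanged only when it has no half literal. *)
Lemma half_part_pair C :
  C \in phi -> half_part C != set0 ->
  exists p : Y, half_part C = [set lit_sub p.1; lit_sub p.2].
Proof.
move=> Cphi; rewrite -card_gt0 => h0.
have lift l : l \in half_part C -> exists z : lit Z, lit_sub z = l.
  case: l => x b; rewrite inE => /andP[_ /= hx].
  by exists (exist _ x hx, b).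
have : (#|half_part C| == 1) || (#|half_part C| == 2).
  by have := card_half_part Cphi; lia.
case/orP.
  case/cards1P=> l hl; have [|z zl] := lift l; first by rewrite hl inE.
  by exists (z, z); rewrite /= zl setUid.
case/cards2P=> l [l' [_ hl]].
have [|z zl] := lift l; first by rewrite hl !inE eqxx.
have [|z' zl'] := lift l'; first by rewrite hl !inE eqxx orbT.
by exists (z, z'); rewrite /= zl zl'.
Qed.

(* The variables outside [x2] default to making the literals of value 0 true, so
   up to renaming [p] is the only possibly positive literal of a Horn clause. *)
Lemma translate_horn C :
  C \in phi -> translate C != set0 ->
  exists2 p, p \in translate C & forall l', l' \in translate C -> l' != p ->
    exists l, [/\ l' = lit_inl l, l.1 \notin x2 & gamma l = 0%R].
Proof.
move=> Cphi; rewrite /translate; case: pickP => [p /eqP halfC | nohalf] ne.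
  exists (inr p, true); first by rewrite !inE eqxx.
  move=> l'; rewrite !inE => /orP[-> //|/imsetP[l + ->] _].
  rewrite !inE => /andP[+ lC]; rewrite lC /= => lx2; exists l; split=> //.
  (* A literal of value 1 beside a half literal would give a sum of at least 3/2. *)
  case: (gamma_int lx2) => // l1.
  have : lit_sub p.1 \in half_part C by rewrite halfC !inE eqxx.
  rewrite inE => /andP[hC hx2].
  have lh : l != lit_sub p.1 by apply: contraNneq lx2 => ->.
  have := gamma_pair Cphi lC hC lh; rewrite l1 (gamma_half hx2); lra.
have half0 : half_part C = set0.
  apply/eqP; apply: contraT => /(half_part_pair Cphi)[p hp].
  by have := nohalf p; rewrite hp eqxx.
have notx2 l : l \in C -> l.1 \notin x2.
  by move=> lC; have := in_set0 l; rewrite -half0 inE lC /= => ->.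
(* Without half literals, [p] is the literal of value 1, unique since two would sum to 2; if there
   is none, any literal serves. *)
case: (pickP [pred l in C | gamma l == 1%R]) => [l /andP[/= lC /eqP l1]|no1].
  exists (lit_inl l); first exact: imset_f.
  move=> _ /imsetP[h hC ->] hl; exists h; split=> //; first exact: notx2.
  case: (gamma_int (notx2 _ hC)) => // h1.
  have lh : l != h by apply: contraNneq hl => ->.
  have := gamma_pair Cphi lC hC lh; rewrite l1 h1; lra.
case/set0Pn: ne => p pD; exists p => // _ /imsetP[h hC ->] _.
exists h; split=> //; first exact: notx2.
case: (gamma_int (notx2 _ hC)) => // h1.
by have := no1 h; rewrite /= hC h1 eqxx.
Qed.

Lemma urc_encode : urc (encode phi).
Proof.
apply: urc_unit_closed => U consU closedU ne.
(* [T] is the 2-CNF of the auxiliary variables true in [U], and [W] the part of [U] on [x2];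
   propagation through the added clauses gives their closure properties. *)
pose T : rel (lit Z) := fun l1 l2 => (inr (l1, l2), true) \in U.
pose W := [set l : lit Z | lit_inl (lit_sub l) \in U].
have propSwap l1 l2 : T l1 l2 -> T l2 l1.
  move=> T12; apply: (closedU _ _ (swap_in_encode phi (l1, l2))).
    by rewrite !inE eqxx orbT.
  by move=> l'; rewrite !inE => /orP[/eqP->|->].
have propSound l1 l2 : T l1 l2 -> neg_lit l1 \in W \/ l1 = l2 -> l2 \in W.
  move=> T12 h; rewrite inE.
  apply: (closedU _ _ (sound_in_encode phi (l1, l2))).
    by rewrite !inE eqxx orbT.
  move=> l'; rewrite !inE -orbA => /or3P[/eqP-> //|/eqP->|->//].
  by case: h => [|->]; rewrite ?inE ?eqxx.
have [|||||m mW mT] := @resolution_closed_2cnf_sat Z T W.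
- by move=> l1 l2; apply/idP/idP; apply: propSwap.
- move=> l1 l2 l3 T12 T23.
  apply: (closedU _ _ (resolution_in_encode phi (l1, l2, l3))).
    by rewrite !inE eqxx orbT.
  by move=> l'; rewrite !inE -orbA => /or3P[/eqP->|/eqP->|->].
- by move=> l; rewrite !inE => /consU.
- by move=> l1 l2 T12 W1; apply: propSound T12 _; left.
- by move=> l Tl; apply: propSound Tl _; right.
(* Outside [x2], an undecided variable makes its literal of value 0 true. The model [m] settles
   [x2], and undecided auxiliary variables become false. *)
pose dflt x := ((inl x, true) \in U) ||
  (((inl x, false) \notin U) && (gamma (x, true) == 0%R)).
pose a : assignment (X + Y) := [ffun v => match v with
  | inl x => if insub x is Some z then m z else dflt x
  | inr p => (inr p, true) \in U end].
have a_sub l : lit_eval a (lit_inl (lit_sub l)) = lit_eval m l.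
  by rewrite /lit_eval ffunE /= valK.
have a_inr p : lit_eval a (inr p, false) = ((inr p, true) \notin U).
  by rewrite /lit_eval ffunE /=; case: (_ \in U).
have aU l : l \in U -> lit_eval a l.
  case: l => [[x|p] b] lU; last first.
    case: b lU => lU; rewrite /lit_eval ffunE /=; first by rewrite lU.
    by have /negbTE-> := consU _ lU.
  have [xx2|xx2] := boolP (x \in x2).
    by have := a_sub (exist _ x xx2, b) => ->; apply: mW; rewrite inE.
  rewrite /lit_eval ffunE /= insubN // /dflt; case: b lU => lU; rewrite lU //=.
  by have /negbTE-> := consU _ lU.
(* By the choice of defaults, a literal of value 0 is false only when [U] refutes it. *)
have a_dflt l : l.1 \notin x2 -> gamma l = 0%R ->
    ~~ lit_eval a (lit_inl l) -> neg_lit (lit_inl l) \in U.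
  case: l => x b /= xx2 g0; rewrite /lit_eval ffunE /= insubN // /dflt.
  rewrite /neg_lit /=; case: b g0 => g0.
    rewrite g0 eqxx andbT eqb_id negb_or negbK => /andP[] //.
  have -> : gamma (x, true) == 0%R = false.
    case: qhorn => _ /(_ (x, true)) + _; rewrite /neg_lit /= g0 addr0 => ->.
    exact/negbTE/oner_neq0.
  by rewrite andbF orbF; case: (_ \in U).
exists a => //; apply: cnf_eval_encode => [C Cphi|p|p|t].
- have trC := translate_in_encode Cphi.
  have [|p pC others] := translate_horn Cphi.
    by apply: contraNneq ne => <-.
  apply: (clause_eval_unit_closed closedU aU trC pC) => l' l'C l'p.
  by case: (others _ l'C l'p) => l [-> lx2 g0]; apply: a_dflt.
- case: (boolP (lit_eval a (inr p, false))) => ap.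
    by apply/exists_inP; exists (inr p, false); rewrite // !inE eqxx.
  (* A true auxiliary variable is in [U], so its clause belongs to [T] and is satisfied by [m]. *)
  have /mT : T p.1 p.2 by move: ap; rewrite a_inr negbK /T -surjective_pairing.
  by rewrite -!a_sub => /orP[] al; apply/exists_inP;
    eexists; try exact: al; rewrite !inE eqxx ?orbT.
(* Swap and resolution clauses are Horn in the auxiliary variables, whose negative literals are
   false only if [U] refutes them. *)
- apply: (clause_eval_unit_closed closedU aU (swap_in_encode phi p)
    (p := (inr (p.2, p.1), true))); first by rewrite !inE eqxx orbT.
  by move=> l; rewrite !inE => /orP[/eqP->|->//] _; rewrite a_inr negbK.
- apply: (clause_eval_unit_closed closedU aU (resolution_in_encode phi t)
    (p := (inr (t.1.1, t.2), true))); first by rewrite !inE eqxx orbT.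
  by move=> l; rewrite !inE -orbA => /or3P[/eqP->|/eqP->|->//] _;
    rewrite a_inr negbK.
Qed.

End Urc.
End Encoding.

(** * Existence of the encoding with an explicit constant *)

Theorem theorem6 :
  exists c : nat,
  forall (X : finType) (phi : cnf X) (gamma : lit X -> rat)
         (f : assignment X -> bool) (x1 x2 : {set X}),
    qhorn_valuation phi gamma ->
    represents phi f ->
    x1 :|: x2 = [set: X] ->
    [disjoint x1 & x2] ->
    (forall x : X, x \in x1 ->
       gamma (x, true) = 0%R \/ gamma (x, true) = 1%R) ->
    (forall x : X, x \in x2 -> gamma (x, true) = (1 / 2%:R)%R) ->
    exists (Y : finType) (psi : cnf (X + Y)%type),
      [/\ urc_encoding psi f,
          #|Y| <= c * #|x2| ^ 2,
          #|psi| <= c * (#|phi| + #|x2| ^ 3)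
        & cnf_length psi <= c * (cnf_length phi + #|x2| ^ 3)].
Proof.
exists 44 => X phi gamma f x1 x2 qhorn rep cover _ g1 g2.
(* The hypotheses constrain positive literals only; complementation carries them over to negative
   ones. *)
have gamma_neg x : (gamma (x, false) = 1 - gamma (x, true))%R.
  by case: qhorn => _ /(_ (x, true)) <- _; rewrite /neg_lit /= addrAC subrr add0r.
have notx2 x : x \notin x2 -> x \in x1.
  by have := in_setT x; rewrite -cover inE => /orP[// | ->].
exists _, (encode x2 phi); split.
- split; first exact: encoding_encode.
  apply: (urc_encode qhorn) => -[x []] /= hx; rewrite ?gamma_neg.
  + exact: g2.
  + by rewrite g2 //; lra.
  + exact/g1/notx2.
  + case: (g1 _ (notx2 _ hx)) => ->; first by right; rewrite subr0.
    by left; rewrite subrr.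
- by rewrite card_pair leq_mul2r orbT.
- exact: card_encode.
- exact: cnf_length_encode.
Qed.
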